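(* Let $N\ge 1$, let $$\Omega' = \begin{pmatrix} I_{(N+2)(N-1)/2} & 0 \\ 0 & -I_{N(N-1)/2} \end{pmatrix}\in M_{N^2-1}(\mathbb{C}),$$ and define the real vector space $V$ (of row vectors) and the multiplicative semigroup $S$ by $$V = \left\{ v \in \mathbb{C}^{N^2-1} \mid \overline{v} = v \Omega' \right\},\qquad S = \left\{ B \in M_{N^2-1}(\mathbb{C}) \mid \Omega' \overline{B} = B \Omega' \right\}.$$ Then there is an isomorphism of semigroups $$\operatorname{Pert}(M_N(\mathbb{C})) \cong V \rtimes S,$$ where $V\rtimes S$ is the set $V\times S$ with the semigroup law $(v,B)\cdot(v',B') = (v' + vB', BB')$.
   Context: Bars denote entrywise complex conjugation. For a complex associative unital $*$-algebra $\mathcal{A}$, the opposite algebra $\mathcal{A}^\circ$ is the vector space $\mathcal{A}$, with elements written $a^\circ$, and product $a^\circ b^\circ=(ba)^\circ$. The perturbation semigroup $\operatorname{Pert}(\mathcal{A})$ is the set of elements of $\mathcal{A}\otimes_{\mathbb{C}}\mathcal{A}^\circ$ of the form $\sum_j a_j\otimes b_j^\circ$ (finite sum) with $\sum_j a_jb_j=1$ and $\sum_j a_j\otimes b_j^\circ=\sum_j b_j^*\otimes a_j^{*\circ}$; it is a unital semigroup under the multiplication of $\mathcal{A}\otimes_{\mathbb{C}}\mathcal{A}^\circ$. $M_N(\mathbb{C})$ is regarded as a complex $*$-algebra with involution conjugate transposition. *)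

(* Defs.v *)
From HB Require Import structures.
From mathcomp Require Import all_boot all_order all_algebra.
From mathcomp Require Import boolp reals.
From mathcomp Require Import complex zify.
Set Implicit Arguments.
Unset Strict Implicit.
Unset Printing Implicit Defensive.
Import GRing.Theory Num.Theory.
Local Open Scope ring_scope.
Local Open Scope quotient_scope.

Reserved Notation "u '⊗' v" (at level 38, left associativity).
Reserved Notation "x ^☆" (at level 1, format "x ^☆").

HB.mixin Record isStarAlgebra (C : numClosedFieldType) A
    of GRing.Algebra C A := {
  star : A -> A;
  starD : forall x y : A, star (x + y) = star x + star y;
  starZ : forall (a : C) (x : A), star (a *: x) = a^* *: star x;
  starM : forall x y : A, star (x * y) = star y * star x;
  starK : involutive star
}.

#[short(type="starAlgType")]
HB.structure Definition StarAlgebra (C : numClosedFieldType) :=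
  {A of GRing.Algebra C A & isStarAlgebra C A}.

Notation "x ^☆" := (star x) : ring_scope.

(* The opposite algebra is the converse ring A^c; a° is a seen in A^c. *)
HB.instance Definition _ (C : pzRingType) (A : lmodType C) :=
  GRing.Zmodule_isLmodule.Build C A^c
    (@scalerA C A) (@scale1r C A) (@scalerDr C A) (@scalerDl C A).

HB.instance Definition _ (C : pzRingType) (A : algType C) :=
  GRing.LSemiModule_isLSemiAlgebra.Build C A^c
    (fun a x y => @scalerAr C A a y x).

HB.instance Definition _ (C : pzRingType) (A : algType C) :=
  GRing.LSemiAlgebra_isSemiAlgebra.Build C A^c
    (fun a x y => @scalerAl C A a y x).

(* Size n.+1 because algType excludes the zero algebra. *)
Section MatrixStar.
Variables (C : numClosedFieldType) (n : nat).
Implicit Types x y : 'M[C]_n.+1.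

Definition mxstar x : 'M[C]_n.+1 := map_mx Num.conj x^T.

Lemma mxstarD x y : mxstar (x + y) = mxstar x + mxstar y.
Proof. by rewrite /mxstar linearD map_mxD. Qed.

Lemma mxstarZ (a : C) x : mxstar (a *: x) = a^* *: mxstar x.
Proof. by rewrite /mxstar linearZ map_mxZ. Qed.

Lemma mxstarM x y : mxstar (x * y) = mxstar y * mxstar x.
Proof. by rewrite /mxstar trmx_mul map_mxM. Qed.

Lemma mxstarK : involutive mxstar.
Proof. by move=> x; apply/matrixP=> i j; rewrite !mxE conjCK. Qed.

HB.instance Definition _ :=
  isStarAlgebra.Build C 'M[C]_n.+1 mxstarD mxstarZ mxstarM mxstarK.
End MatrixStar.

Section Tensor.
Variables (C : comPzRingType) (U V : lmodType C).

(* The list [:: (u1, v1); ...; (un, vn)] stands for u1 ⊗ v1 + ... + un ⊗ vn.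
   Scalars need no separate place: they are absorbed in the first factor. *)
Inductive tens_cong : seq (U * V) -> seq (U * V) -> Prop :=
| TensRefl s : tens_cong s s
| TensSym s t : tens_cong s t -> tens_cong t s
| TensTrans s t r : tens_cong s t -> tens_cong t r -> tens_cong s r
| TensCat s s' t t' :
    tens_cong s s' -> tens_cong t t' -> tens_cong (s ++ t) (s' ++ t')
| TensCatC s t : tens_cong (s ++ t) (t ++ s)
| Tens0 v : tens_cong [:: (0, v)] [::]
| TensDl u u' v : tens_cong [:: (u + u', v)] [:: (u, v); (u', v)]
| TensDr u v v' : tens_cong [:: (u, v + v')] [:: (u, v); (u, v')]
| TensZ (a : C) u v : tens_cong [:: (a *: u, v)] [:: (u, a *: v)].

Definition tens_rel (s t : seq (U * V)) : bool := `[< tens_cong s t >].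

Lemma tens_rel_refl : reflexive tens_rel.
Proof. by move=> s; apply/asboolP; apply: TensRefl. Qed.

Lemma tens_rel_sym : symmetric tens_rel.
Proof.
by move=> s t; apply/asboolP/asboolP; apply: TensSym.
Qed.

Lemma tens_rel_trans : transitive tens_rel.
Proof.
by move=> t s r /asboolP st /asboolP tr; apply/asboolP; apply: TensTrans st tr.
Qed.

Canonical tens_equiv :=
  EquivRel tens_rel tens_rel_refl tens_rel_sym tens_rel_trans.

Definition tensor := {eq_quot tens_equiv}.
HB.instance Definition _ := Choice.on tensor.
HB.instance Definition _ := EqQuotient.on tensor.

Lemma tens_piP (s t : seq (U * V)) :
  \pi_tensor s = \pi_tensor t <-> tens_cong s t.
Proof.
split=> [/eqP|st]; first by rewrite piE => /asboolP.
by apply/eqP; rewrite piE; apply/asboolP.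
Qed.

Lemma tens_piW (P : tensor -> Prop) :
  (forall s, P (\pi_tensor s)) -> forall x, P x.
Proof. by move=> Ppi x; rewrite -[x]reprK. Qed.

Lemma tens_repr s : tens_cong (repr (\pi_tensor s)) s.
Proof. by apply/tens_piP; rewrite reprK. Qed.

Definition tens_zero : tensor := \pi_tensor [::].
Definition tens_add (x y : tensor) : tensor := \pi_tensor (repr x ++ repr y).
Definition tens_opp (x : tensor) : tensor :=
  \pi_tensor [seq (- p.1, p.2) | p <- repr x].

Lemma tens_add_pi s t :
  tens_add (\pi_tensor s) (\pi_tensor t) = \pi_tensor (s ++ t).
Proof. by apply/tens_piP; apply: TensCat; apply: tens_repr. Qed.

Lemma tens_addA : associative tens_add.
Proof.
elim/tens_piW=> s; elim/tens_piW=> t; elim/tens_piW=> r.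
by rewrite !tens_add_pi catA.
Qed.

Lemma tens_addC : commutative tens_add.
Proof.
by elim/tens_piW=> s; elim/tens_piW=> t; rewrite !tens_add_pi; apply/tens_piP; exact: TensCatC.
Qed.

Lemma tens_add0 : left_id tens_zero tens_add.
Proof. by elim/tens_piW=> s; rewrite tens_add_pi. Qed.

Lemma tens_addN : left_inverse tens_zero tens_opp tens_add.
Proof.
move=> x; rewrite -{2}[x]reprK tens_add_pi; apply/tens_piP.
elim: (repr x) => [|[u v] s IHs] /=; first exact: TensRefl.
apply: (@TensTrans _ ([:: (- u, v); (u, v)] ++
                     ([seq (- p.1, p.2) | p <- s] ++ s))).
  rewrite -[_ :: _ ++ _]cat1s -[_ ++ (_ ++ s)]/([:: _] ++ ([:: (u, v)] ++ (_ ++ s))).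
  apply: TensCat; first exact: TensRefl.
  rewrite -[(u, v) :: s]cat1s !catA.
  by apply: TensCat; [apply: TensCatC|apply: TensRefl].
rewrite -[[::]]cats0; apply: TensCat IHs.
apply: TensTrans (Tens0 v); apply: TensSym.
by rewrite -[X in (X, v)](addNr u); apply: TensDl.
Qed.

HB.instance Definition _ :=
  GRing.isZmodule.Build tensor tens_addA tens_addC tens_add0 tens_addN.

Definition tens (u : U) (v : V) : tensor := \pi_tensor [:: (u, v)].
Local Notation "u ⊗ v" := (tens u v).

Lemma tens_pi_sum s : \pi_tensor s = \sum_(p <- s) p.1 ⊗ p.2.
Proof.
elim: s => [|[u v] s IHs]; first by rewrite big_nil.
by rewrite big_cons /= -IHs; rewrite -[LHS](tens_add_pi [:: (u, v)] s).
Qed.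

Lemma tens_sum_repr (x : tensor) : x = \sum_(p <- repr x) p.1 ⊗ p.2.
Proof. by rewrite -tens_pi_sum reprK. Qed.

Lemma tensDl u u' v : (u + u') ⊗ v = u ⊗ v + u' ⊗ v.
Proof.
by rewrite [RHS](tens_add_pi [:: (u, v)] [:: (u', v)]); apply/tens_piP; exact: TensDl.
Qed.

Lemma tensDr u v v' : u ⊗ (v + v') = u ⊗ v + u ⊗ v'.
Proof.
by rewrite [RHS](tens_add_pi [:: (u, v)] [:: (u, v')]); apply/tens_piP; exact: TensDr.
Qed.

Lemma tensZlr (a : C) u v : (a *: u) ⊗ v = u ⊗ (a *: v).
Proof. by apply/tens_piP; exact: TensZ. Qed.

Lemma tens_ind (P : tensor -> Prop) :
    P 0 -> (forall u v, P (u ⊗ v)) -> (forall x y, P x -> P y -> P (x + y)) ->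
  forall x, P x.
Proof. by move=> P0 Pt PD x; rewrite [x]tens_sum_repr; elim/big_ind: _. Qed.

Definition balanced (W : zmodType) (f : U -> V -> W) :=
  [/\ forall u u' v, f (u + u') v = f u v + f u' v,
      forall u v v', f u (v + v') = f u v + f u v' &
      forall (a : C) u v, f (a *: u) v = f u (a *: v)].

Definition tens_lift (W : zmodType) (f : U -> V -> W) (x : tensor) : W :=
  \sum_(p <- repr x) f p.1 p.2.

Section Lift.
Variables (W : zmodType) (f : U -> V -> W).
Hypothesis fB : balanced f.

Lemma tens_lift_pi s : tens_lift f (\pi_tensor s) = \sum_(p <- s) f p.1 p.2.
Proof.
case: fB => fDl fDr fZ; rewrite /tens_lift.
suff sumE t t' : tens_cong t t' ->
    \sum_(p <- t) f p.1 p.2 = \sum_(p <- t') f p.1 p.2.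
  exact/sumE/tens_repr.
elim=> {s t t'} // [s t r _ -> _ -> //|s s' t t' _ IHs _ IHt|s t|v|u u' v
  |u v v'|a u v].
- by rewrite !big_cat IHs IHt.
- by rewrite !big_cat; apply: addrC.
- rewrite big_seq1 big_nil /=.
  by apply: (addrI (f 0 v)); rewrite -fDl !addr0.
- by rewrite !(big_cons, big_nil) !addr0 /= ?fDl ?fDr.
- by rewrite !(big_cons, big_nil) !addr0 /= ?fDl ?fDr.
- by rewrite !big_seq1 /= fZ.
Qed.

Lemma tens_lift_tens u v : tens_lift f (u ⊗ v) = f u v.
Proof. by rewrite tens_lift_pi big_seq1. Qed.

Lemma tens_liftD : {morph tens_lift f : x y / x + y}.
Proof.
elim/tens_piW=> s; elim/tens_piW=> t.
by rewrite [X in tens_lift f X]tens_add_pi !tens_lift_pi big_cat.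
Qed.

Lemma tens_lift0 : tens_lift f 0 = 0.
Proof.
by rewrite [X in tens_lift f X](_ : 0 = \pi_tensor [::]) // tens_lift_pi big_nil.
Qed.
End Lift.

Definition tens_scale (a : C) : tensor -> tensor :=
  tens_lift (fun u v => (a *: u) ⊗ v).

Lemma tens_scale_balanced (a : C) : balanced (fun u v => (a *: u) ⊗ v).
Proof.
split=> [u u' v|u v v'|b u v]; first by rewrite scalerDr tensDl.
  by rewrite tensDr.
by rewrite scalerA mulrC -scalerA tensZlr.
Qed.
Let scB := tens_scale_balanced.

Lemma tens_scaleA a b x : tens_scale a (tens_scale b x) = tens_scale (a * b) x.
Proof.
elim/tens_ind: x => [|u v|x y IHx IHy].
- by rewrite /tens_scale !(tens_lift0 (scB _)).
- by rewrite /tens_scale !(tens_lift_tens (scB _)) scalerA.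
- by move: IHx IHy; rewrite /tens_scale !(tens_liftD (scB _)) => -> ->.
Qed.

Lemma tens_scale1 : left_id 1 tens_scale.
Proof.
elim/tens_ind=> [|u v|x y IHx IHy].
- by rewrite /tens_scale (tens_lift0 (scB _)).
- by rewrite /tens_scale (tens_lift_tens (scB _)) scale1r.
- by move: IHx IHy; rewrite /tens_scale (tens_liftD (scB _)) => -> ->.
Qed.

Lemma tens_scaleDr : right_distributive tens_scale +%R.
Proof. by move=> a x y; apply: tens_liftD (scB a) x y. Qed.

Lemma tens_scaleDl x : {morph tens_scale^~ x : a b / a + b}.
Proof.
move=> a b; elim/tens_ind: x => [|u v|x y IHx IHy].
- by rewrite /tens_scale !(tens_lift0 (scB _)) addr0.
- by rewrite /tens_scale !(tens_lift_tens (scB _)) scalerDl tensDl.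
- by move: IHx IHy; rewrite /tens_scale !(tens_liftD (scB _)) => -> ->; rewrite addrACA.
Qed.

HB.instance Definition _ := GRing.Zmodule_isLmodule.Build C tensor
  tens_scaleA tens_scale1 tens_scaleDr tens_scaleDl.

Lemma tensZl (a : C) u v : (a *: u) ⊗ v = a *: (u ⊗ v).
Proof. by rewrite [RHS](tens_lift_tens (scB a)). Qed.

Lemma tensZr (a : C) u v : u ⊗ (a *: v) = a *: (u ⊗ v).
Proof. by rewrite -tensZlr tensZl. Qed.
End Tensor.

Notation "u ⊗ v" := (tens u v) : ring_scope.

Section TensorAlgebra.
Variables (C : comPzRingType) (A B : algType C).
Local Notation T := (tensor A B).

Definition tens_mul (x y : T) : T :=
  tens_lift (fun a b => tens_lift (fun a' b' => (a * a') ⊗ (b * b')) y) x.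

Lemma tens_mul_balancedr a b :
  balanced (fun (a' : A) (b' : B) => (a * a') ⊗ (b * b')).
Proof.
split=> [u u' v|u v v'|c u v]; first by rewrite mulrDr tensDl.
  by rewrite mulrDr tensDr.
by rewrite -!scalerAr tensZlr.
Qed.
Let mrB := tens_mul_balancedr.

Lemma tens_mul_balancedl (y : T) :
  balanced (fun a b => tens_lift (fun a' b' => (a * a') ⊗ (b * b')) y).
Proof.
split=> [u u' v|u v v'|c u v]; elim/tens_ind: y => [|a b|x y IHx IHy];
  rewrite ?(tens_lift0 (mrB _ _)) ?(tens_lift_tens (mrB _ _)) ?addr0 //.
- by rewrite mulrDl tensDl.
- by rewrite !(tens_liftD (mrB _ _)) IHx IHy addrACA.
- by rewrite mulrDl tensDr.
- by rewrite !(tens_liftD (mrB _ _)) IHx IHy addrACA.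
- by rewrite -!scalerAl tensZlr.
- by rewrite !(tens_liftD (mrB _ _)) IHx IHy.
Qed.
Let mlB := tens_mul_balancedl.

Lemma tens_mul_tens (a a' : A) (b b' : B) :
  tens_mul (a ⊗ b) (a' ⊗ b') = (a * a') ⊗ (b * b').
Proof. by rewrite /tens_mul (tens_lift_tens (mlB _)) (tens_lift_tens (mrB _ _)). Qed.

Lemma tens_mulDl : left_distributive tens_mul +%R.
Proof. by move=> x y z; rewrite /tens_mul (tens_liftD (mlB _)). Qed.

Lemma tens_mul0l y : tens_mul 0 y = 0.
Proof. by rewrite /tens_mul (tens_lift0 (mlB _)). Qed.

Lemma tens_mulDr : right_distributive tens_mul +%R.
Proof.
move=> x y z; elim/tens_ind: x => [|a b|x x' IHx IHx'].
- by rewrite !tens_mul0l addr0.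
- by rewrite /tens_mul !(tens_lift_tens (mlB _)) (tens_liftD (mrB _ _)).
- by rewrite !tens_mulDl IHx IHx' addrACA.
Qed.

Lemma tens_mul0r x : tens_mul x 0 = 0.
Proof. by apply: (addrI (tens_mul x 0)); rewrite -tens_mulDr !addr0. Qed.

Lemma tens_mulA : associative tens_mul.
Proof.
move=> x y z; elim/tens_ind: x => [|a b|x x' IHx IHx'].
- by rewrite !tens_mul0l.
- elim/tens_ind: y => [|a' b'|y y' IHy IHy'].
  + by rewrite !(tens_mul0l, tens_mul0r).
  + elim/tens_ind: z => [|a2 b2|z z' IHz IHz'].
    * by rewrite !tens_mul0r.
    * by rewrite !tens_mul_tens !mulrA.
    * by rewrite !tens_mulDr IHz IHz'.
  + by rewrite !(tens_mulDl, tens_mulDr) IHy IHy'.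
- by rewrite !tens_mulDl IHx IHx'.
Qed.

Definition tens_one : T := 1 ⊗ 1.

Lemma tens_mul1 : left_id tens_one tens_mul.
Proof.
elim/tens_ind=> [|a b|x y IHx IHy]; first by rewrite tens_mul0r.
  by rewrite tens_mul_tens !mul1r.
by rewrite tens_mulDr IHx IHy.
Qed.

Lemma tens_mulr1 : right_id tens_one tens_mul.
Proof.
elim/tens_ind=> [|a b|x y IHx IHy]; first by rewrite tens_mul0l.
  by rewrite tens_mul_tens !mulr1.
by rewrite tens_mulDl IHx IHy.
Qed.

HB.instance Definition _ := GRing.Zmodule_isPzRing.Build T
  tens_mulA tens_mul1 tens_mulr1 tens_mulDl tens_mulDr.

Lemma tensM (a a' : A) (b b' : B) : (a ⊗ b) * (a' ⊗ b') = (a * a') ⊗ (b * b').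
Proof. exact: tens_mul_tens. Qed.

Lemma tens_scaleAl (c : C) (x y : T) : c *: (x * y) = (c *: x) * y.
Proof.
elim/tens_ind: x => [|a b|x x' IHx IHx'].
- by rewrite mul0r scaler0 mul0r.
- elim/tens_ind: y => [|a' b'|y y' IHy IHy'].
  + by rewrite !mulr0 scaler0.
  + by rewrite tensM -!tensZl tensM scalerAl.
  + by rewrite !mulrDr scalerDr IHy IHy'.
- by rewrite mulrDl !scalerDr mulrDl IHx IHx'.
Qed.

Lemma tens_scaleAr (c : C) (x y : T) : c *: (x * y) = x * (c *: y).
Proof.
elim/tens_ind: x => [|a b|x x' IHx IHx'].
- by rewrite !mul0r scaler0.
- elim/tens_ind: y => [|a' b'|y y' IHy IHy'].
  + by rewrite mulr0 scaler0 mulr0.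
  + by rewrite tensM -!tensZl tensM scalerAr.
  + by rewrite mulrDr !scalerDr mulrDr IHy IHy'.
- by rewrite !mulrDl scalerDr IHx IHx'.
Qed.

End TensorAlgebra.

Section Perturbation.
Variables (C : numClosedFieldType) (A : starAlgType C).

(* The second factor of ⊗ in this section is taken in the opposite algebra. *)
Local Notation "a ⊗° b" := (@tens C A A^c a b) (at level 38).

Definition is_pert (x : tensor A A^c) : Prop :=
  exists s : seq (A * A),
    [/\ x = \sum_(p <- s) p.1 ⊗° p.2,
        \sum_(p <- s) p.1 * p.2 = 1 &
        \sum_(p <- s) p.1 ⊗° p.2 = \sum_(p <- s) p.2^☆ ⊗° p.1^☆].

Record Pert := MkPert { pert_val : tensor A A^c; _ : `[< is_pert pert_val >] }.
HB.instance Definition _ := [isSub for pert_val].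
HB.instance Definition _ := [Choice of Pert by <:].

Lemma star1 : (1 : A)^☆ = 1.
Proof. by rewrite -[LHS]mulr1 -[X in _ * X]starK -starM mulr1 starK. Qed.

Lemma is_pert1 : is_pert 1.
Proof.
exists [:: (1, 1)]; split; rewrite ?big_seq1 //=; first exact: mulr1.
by rewrite star1.
Qed.

Lemma is_pertM x y : is_pert x -> is_pert y -> is_pert (x * y).
Proof.
case=> s [xE s1 sC] [t [yE t1 tC]].
exists [seq (p.1 * q.1, q.2 * p.2) | p <- s, q <- t].
have xyE : x * y = \sum_(p <- [seq (p.1 * q.1, q.2 * p.2) | p <- s, q <- t])
    p.1 ⊗° p.2.
  rewrite big_allpairs_dep xE yE mulr_suml; apply: eq_bigr => p _.
  by rewrite mulr_sumr; apply: eq_bigr => q _; rewrite tensM.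
split=> //.
- rewrite big_allpairs_dep -s1; apply: eq_bigr => p _ /=.
  under eq_bigr do rewrite -mulrA [_ * (_ * p.2)]mulrA.
  by rewrite -mulr_sumr -mulr_suml t1 mul1r.
- rewrite -xyE big_allpairs_dep xE yE sC tC mulr_suml; apply: eq_bigr => p _.
  by rewrite mulr_sumr; apply: eq_bigr => q _; rewrite tensM /= !starM.
Qed.

Lemma is_pert_val (x : Pert) : is_pert (val x).
Proof. exact/asboolP/(valP x). Qed.

Definition pert_one : Pert := MkPert (asboolT is_pert1).
Definition pert_mul (x y : Pert) : Pert :=
  MkPert (asboolT (is_pertM (is_pert_val x) (is_pert_val y))).

Lemma pert_mulA : associative pert_mul.
Proof. by move=> x y z; apply/val_inj; rewrite /= mulrA. Qed.

Lemma pert_mul1 : left_id pert_one pert_mul.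
Proof. by move=> x; apply/val_inj; rewrite /= mul1r. Qed.

Lemma pert_mulr1 : right_id pert_one pert_mul.
Proof. by move=> x; apply/val_inj; rewrite /= mulr1. Qed.

HB.instance Definition _ := isMonoid.Build Pert pert_mulA pert_mul1 pert_mulr1.
End Perturbation.

Arguments Pert {C} A.

Lemma Omega_dim N : ((N + 2) * (N - 1) %/ 2 + N * (N - 1) %/ 2 = N ^ 2 - 1)%N.
Proof.
case: N => // n.
have [k kE] : exists k, (n.+1 * n = k * 2)%N.
  exists (n.+1 * n)./2; rewrite muln2 even_halfK // oddM /=.
  by case: (odd n).
have -> : ((n.+1 + 2) * (n.+1 - 1) = (k + n) * 2)%N by lia.
have -> : (n.+1 * (n.+1 - 1) = k * 2)%N by lia.
by rewrite !mulnK //; lia.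
Qed.

Section SemidirectProduct.
Variables (R : realType) (N : nat).
Local Notation C := R[i].
Local Notation d := (N ^ 2 - 1)%N.

Definition Omega : 'M[C]_d :=
  castmx (Omega_dim N, Omega_dim N)
    (block_mx (1%:M : 'M_((N + 2) * (N - 1) %/ 2)) 0
              0 (- 1%:M : 'M_(N * (N - 1) %/ 2))).

Definition VOmega_pred : {pred 'rV[C]_d} :=
  fun v => map_mx Num.conj v == v *m Omega.
Definition SOmega_pred : {pred 'M[C]_d} :=
  fun B => Omega *m map_mx Num.conj B == B *m Omega.

Record VOmega := MkVOmega {
  VOmega_val :> 'rV[C]_d;
  _ : VOmega_val \in VOmega_pred
}.
HB.instance Definition _ := [isSub for VOmega_val].
HB.instance Definition _ := [Choice of VOmega by <:].

Record SOmega := MkSOmega {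
  SOmega_val :> 'M[C]_d;
  _ : SOmega_val \in SOmega_pred
}.
HB.instance Definition _ := [isSub for SOmega_val].
HB.instance Definition _ := [Choice of SOmega by <:].

Lemma VOmega_zmod_closed : zmod_closed VOmega_pred.
Proof.
split=> [|v w /eqP vV /eqP wV]; apply/eqP; first by rewrite map_mx0 mul0mx.
by rewrite map_mxB vV wV mulmxBl.
Qed.
HB.instance Definition _ :=
  GRing.isZmodClosed.Build 'rV[C]_d VOmega_pred VOmega_zmod_closed.
HB.instance Definition _ := [SubChoice_isSubZmodule of VOmega by <:].

Lemma VOmega_scale_closed (a : R) (v : VOmega) :
  a%:C%C *: VOmega_val v \in VOmega_pred.
Proof.
case: v => v /= /eqP vV; apply/eqP.
by rewrite map_mxZ vV -scalemxAl; congr (_ *: _); apply: conjc_real.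
Qed.

Definition VOmega_scale (a : R) (v : VOmega) : VOmega :=
  MkVOmega (VOmega_scale_closed a v).

Lemma VOmega_scaleA a b v :
  VOmega_scale a (VOmega_scale b v) = VOmega_scale (a * b) v.
Proof. by apply/val_inj; rewrite /= scalerA rmorphM. Qed.

Lemma VOmega_scale1 : left_id 1 VOmega_scale.
Proof. by move=> v; apply/val_inj; rewrite /= rmorph1 scale1r. Qed.

Lemma VOmega_scaleDr : right_distributive VOmega_scale +%R.
Proof. by move=> a v w; apply/val_inj; rewrite /= scalerDr. Qed.

Lemma VOmega_scaleDl v : {morph VOmega_scale^~ v : a b / a + b}.
Proof. by move=> a b; apply/val_inj; rewrite /= rmorphD scalerDl. Qed.

HB.instance Definition _ := GRing.Zmodule_isLmodule.Build R VOmega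
  VOmega_scaleA VOmega_scale1 VOmega_scaleDr VOmega_scaleDl.

Lemma SOmega_mul_closed (B B' : SOmega) :
  SOmega_val B *m SOmega_val B' \in SOmega_pred.
Proof.
case: B B' => [B /= /eqP BS] [B' /= /eqP BS'].
by apply/eqP; rewrite map_mxM mulmxA BS -mulmxA BS' mulmxA.
Qed.

Definition SOmega_mul (B B' : SOmega) : SOmega :=
  MkSOmega (SOmega_mul_closed B B').

Lemma SOmega_mulA : associative SOmega_mul.
Proof. by move=> A B D; apply/val_inj; rewrite /= mulmxA. Qed.

HB.instance Definition _ := isSemigroup.Build SOmega SOmega_mulA.

Lemma SOmega_act_closed (v : VOmega) (B : SOmega) :
  VOmega_val v *m SOmega_val B \in VOmega_pred.
Proof.
case: v B => [v /= /eqP vV] [B /= /eqP BS].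
by apply/eqP; rewrite map_mxM vV -[LHS]mulmxA BS mulmxA.
Qed.

Definition SOmega_act (v : VOmega) (B : SOmega) : VOmega :=
  MkVOmega (SOmega_act_closed v B).

(* An alias of the product type, so that the componentwise product is not
   inferred. *)
Definition semidirect : Type := VOmega * SOmega.
HB.instance Definition _ := Choice.on semidirect.

Definition semidirect_mul (x y : semidirect) : semidirect :=
  (y.1 + SOmega_act x.1 y.2, (x.2 * y.2)%g).

Lemma semidirect_mulA : associative semidirect_mul.
Proof.
move=> [v A] [w B] [x D]; congr pair; last exact: mulgA.
by apply/val_inj; rewrite /= mulmxDl mulmxA addrA.
Qed.

HB.instance Definition _ := isSemigroup.Build semidirect semidirect_mulA.
End SemidirectProduct.

(* Main.v *)
(* Letting a ⊗ b° act on M_N by x |-> a x b identifies M_N ⊗ M_N° with the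
   algebra of linear endomorphisms of M_N, and Pert(M_N) with those
   endomorphisms T that fix 1 and commute with the involution. Take a basis
   1, e_1, ..., e_(N^2-1) of M_N where each e_j is real and either symmetric or
   antisymmetric, so that star e_j = ω_j e_j with ω_j = 1 or -1 and Ω' is the
   diagonal matrix of the ω_j. In this basis T has a block matrix
   [[1, v], [0, B]]; it commutes with the involution exactly when v is in V and
   B is in S, and products of such block matrices give the semidirect law. *)
Require Import Defs.
From HB Require Import structures.
From mathcomp Require Import all_boot all_algebra.
From mathcomp Require Import reals complex.
From mathcomp Require Import boolp ring zify.

Set Implicit Arguments.
Unset Strict Implicit.
Unset Printing Implicit Defensive.

Import GRing.Theory Num.Theory.

(** * Two-sided multiplication as an action of A ⊗ A° on A *)

Section TensorAction.
Local Open Scope ring_scope.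
Variables (C : comPzRingType) (A : algType C).
Local Notation T := (tensor A A^c).
Implicit Types (t : T) (a x : A).

Definition two_sided_mul x (a : A) (b : A^c) : A := a * x * (b : A).

Lemma two_sided_mul_balanced x : balanced (two_sided_mul x).
Proof.
split=> [u u' v|u v v'|k u v]; rewrite /two_sided_mul.
- by rewrite !mulrDl.
- by rewrite mulrDr.
- by rewrite -!scalerAl -scalerAr.
Qed.

Definition tens_act t x : A := tens_lift (two_sided_mul x) t.

Lemma tens_act_tens a (b : A^c) x : tens_act (a ⊗ b) x = a * x * (b : A).
Proof. exact/tens_lift_tens/two_sided_mul_balanced. Qed.

Lemma tens_act0 x : tens_act 0 x = 0.
Proof. exact/tens_lift0/two_sided_mul_balanced. Qed.

Lemma tens_actD t t' x : tens_act (t + t') x = tens_act t x + tens_act t' x.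
Proof. exact/tens_liftD/two_sided_mul_balanced. Qed.

Lemma tens_act_sum I (r : seq I) (P : pred I) (F : I -> T) x :
  tens_act (\sum_(i <- r | P i) F i) x = \sum_(i <- r | P i) tens_act (F i) x.
Proof.
by apply: (big_morph (tens_act^~ x)) => [t t'|]; rewrite ?tens_actD ?tens_act0.
Qed.

Lemma tens_act_linear t : linear (tens_act t).
Proof.
move=> k x y; elim/tens_ind: t => [|a b|t t' IHt IHt'].
- by rewrite !tens_act0 scaler0 addr0.
- by rewrite !tens_act_tens mulrDr mulrDl -scalerAr -scalerAl.
- by rewrite !tens_actD IHt IHt' scalerDr addrACA.
Qed.

HB.instance Definition _ t :=
  GRing.isLinear.Build C A A *:%R (tens_act t) (tens_act_linear t).

(** The order reversal in [A^c] is what makes this hold: [a * (a' * x * b') * b] has the right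
    factor [b' * b], which is [b * b'] in [A^c]. *)
Lemma tens_actM t t' x : tens_act (t * t') x = tens_act t (tens_act t' x).
Proof.
elim/tens_ind: t => [|a b|t1 t2 IH1 IH2].
- by rewrite mul0r !tens_act0.
- elim/tens_ind: t' => [|a' b'|t1 t2 IH1 IH2].
  + by rewrite mulr0 tens_act0 linear0.
  + rewrite tensM !tens_act_tens.
    by rewrite -[(b * b')%R]/((b' : A) * (b : A)) !mulrA.
  + by rewrite mulrDr !tens_actD IH1 IH2 linearD.
- by rewrite mulrDl !tens_actD IH1 IH2.
Qed.
End TensorAction.

(** * Finite sums inside a tensor factor *)

Section TensorSum.
Local Open Scope ring_scope.
Variables (C : comPzRingType) (U V : lmodType C).

Lemma tens_suml I (r : seq I) (F : I -> U) (v : V) :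
  (\sum_(i <- r) F i) ⊗ v = \sum_(i <- r) (F i ⊗ v).
Proof.
apply: (big_morph (fun u => u ⊗ v)) => [u u'|]; first exact: tensDl.
by rewrite -[in LHS](scale0r 0) tensZl scale0r.
Qed.

Lemma tens_sumr I (r : seq I) (F : I -> V) (u : U) :
  u ⊗ (\sum_(i <- r) F i) = \sum_(i <- r) (u ⊗ F i).
Proof.
apply: (big_morph (fun v => u ⊗ v)) => [v v'|]; first exact: tensDr.
by rewrite -[in LHS](scale0r 0) tensZr scale0r.
Qed.
End TensorSum.

(** * Tensors over M_N as linear endomorphisms *)

Section MatrixTensor.
Local Open Scope ring_scope.
Variables (C : comNzRingType) (n : nat).
Local Notation M := 'M[C]_n.+1.
Implicit Types (T : M -> M) (t : tensor M M^c).

(** Inverse of the action. The tensor E_ik ⊗ E_lj sends E_kl to E_ij and kills the other matrix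
    units, so its coefficient must be entry (i, j) of T E_kl. *)
Definition tens_of_map T : tensor M M^c :=
  \sum_i \sum_k \sum_l \sum_j
     T (delta_mx k l) i j *: ((delta_mx i k : M) ⊗ (delta_mx l j : M^c)).

Lemma mul_delta_mx_entry (a b : M) k l i j :
  (a * delta_mx k l * b) i j = a i k * b l j.
Proof.
rewrite -mulrA !mxE (bigD1 k) //= mxE (bigD1 l) //= !mxE !eqxx mul1r.
rewrite !big1 ?addr0 // => q qN; rewrite ?mxE.
  by rewrite big1 ?mulr0 // => q' _; rewrite mxE (negbTE qN) mul0r.
by rewrite eqxx (negbTE qN) mul0r.
Qed.

Lemma tens_actK t : tens_of_map (tens_act t) = t.
Proof.
rewrite /tens_of_map.
elim/tens_ind: t => [|a b|t t' IHt IHt'].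
- by do 4!(apply: big1 => ? _); rewrite tens_act0 mxE scale0r.
- rewrite [in RHS](matrix_sum_delta a) tens_suml; apply: eq_bigr => i _.
  rewrite tens_suml; apply: eq_bigr => k _.
  rewrite [in RHS](matrix_sum_delta b) tens_sumr; apply: eq_bigr => l _.
  rewrite tens_sumr; apply: eq_bigr => j _.
  by rewrite tens_act_tens mul_delta_mx_entry tensZl tensZr scalerA.
- rewrite -[in RHS]IHt -[in RHS]IHt'.
  do 4!(rewrite -big_split; apply: eq_bigr => ? _ /=).
  by rewrite tens_actD mxE scalerDl.
Qed.

Lemma tens_of_mapK T : linear T -> tens_act (tens_of_map T) =1 T.
Proof.
move=> Tlin x.
pose T' : {linear M -> M} :=
  HB.pack T (GRing.isLinear.Build C M M *:%R T Tlin).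
have -> : T x = \sum_k \sum_l x k l *: T (delta_mx k l).
  rewrite -[T]/(T' : M -> M) [x in LHS]matrix_sum_delta linear_sum.
  apply: eq_bigr => k _; rewrite linear_sum; apply: eq_bigr => l _.
  by rewrite linearZ.
have delta_mulE k l i j :
    delta_mx i k * x * delta_mx l j = x k l *: delta_mx i j :> M.
  apply/matrixP => p q; rewrite !mxE (bigD1 l) //= big1 => [|r rN].
    rewrite !mxE (bigD1 k) //= big1 => [|r rN]; rewrite ?mxE ?eqxx ?addr0.
      case: (p == i); case: (q == j); rewrite /=;
        by rewrite ?(mul1r, mul0r, mulr1, mulr0).
    by rewrite (negbTE rN) andbF mul0r.
  by rewrite !mxE (negbTE rN) mulr0.
transitivity (\sum_i \sum_k \sum_l \sum_j
    (x k l * T (delta_mx k l) i j) *: delta_mx i j).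
  do 4!(rewrite tens_act_sum; apply: eq_bigr => ? _).
  by rewrite -tensZl tens_act_tens -!scalerAl delta_mulE scalerA mulrC.
(* The sums run over i, k, l, j; moving i past k and l leaves the expansion of [T (delta_mx k l)] as
   the inner double sum. *)
rewrite exchange_big; apply: eq_bigr => k _.
rewrite exchange_big; apply: eq_bigr => l _.
rewrite [in RHS](matrix_sum_delta (T _)) scaler_sumr; apply: eq_bigr => i _.
by rewrite scaler_sumr; apply: eq_bigr => j _; rewrite scalerA.
Qed.

(** [tens_actK] rebuilds a tensor from its action, so equalities of tensors can be tested on
    matrices. *)
Lemma tens_act_inj t t' : tens_act t =1 tens_act t' -> t = t'.
Proof.
by move=> /funext tt'; rewrite -[t]tens_actK -[t']tens_actK tt'.
Qed.
End MatrixTensor.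

(** * The involution, and Pert as a set of endomorphisms *)

Section StarSum.
Local Open Scope ring_scope.
Variables (C : numClosedFieldType) (A : starAlgType C).

Lemma star_sum I (r : seq I) (F : I -> A) :
  (\sum_(i <- r) F i)^☆ = \sum_(i <- r) (F i)^☆.
Proof.
apply: (big_morph (@star C A)) => [x y|]; first exact: starD.
by rewrite -[in LHS](scale0r 0) starZ conjC0 scale0r.
Qed.
End StarSum.

Section Pert.
Local Open Scope ring_scope.
Variables (C : numClosedFieldType) (n : nat).
Local Notation M := 'M[C]_n.+1.
Implicit Types (t : tensor M M^c).

Lemma is_pertP t : is_pert t <->
  tens_act t 1 = 1 /\ (forall x, tens_act t x^☆ = (tens_act t x)^☆).
Proof.
have actE (s : seq (M * M)) x :
    tens_act (\sum_(p <- s) p.1 ⊗ (p.2 : M^c)) x = \sum_(p <- s) p.1 * x * p.2.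
  by rewrite tens_act_sum; apply: eq_bigr => p _; rewrite tens_act_tens.
have act_starE (s : seq (M * M)) x :
    tens_act (\sum_(p <- s) p.2^☆ ⊗ (p.1^☆ : M^c)) x
    = (tens_act (\sum_(p <- s) p.1 ⊗ (p.2 : M^c)) x^☆)^☆.
  rewrite actE star_sum tens_act_sum; apply: eq_bigr => p _.
  by rewrite tens_act_tens !starM starK mulrA.
split=> [[s [-> s1 sC]]|[t1 tC]].
  split=> [|x]; last by rewrite {2}sC act_starE starK.
  by rewrite actE -[RHS]s1; apply: eq_bigr => p _; rewrite mulr1.
have tE := tens_sum_repr t; exists (repr t); split=> //.
  by rewrite -t1 [in RHS]tE actE; apply: eq_bigr => p _; rewrite mulr1.
by apply: tens_act_inj => x; rewrite act_starE -tE tC starK.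
Qed.
End Pert.

(** * A basis of real symmetric and antisymmetric matrices *)

Section SymmetricBasis.
Local Open Scope ring_scope.
Variables (C : numClosedFieldType) (N : nat).
Local Notation M := 'M[C]_N.+1.
Local Notation I := ('I_N.+1 * 'I_N.+1)%type.
Implicit Types (p q : I) (x y : M).

Definition transpose_sign p : C := (-1) ^+ (p.2 < p.1)%N.

(** Indices i < j yield the symmetric E_ij + E_ji at (i, j) and the antisymmetric E_ji - E_ij at (j,
    i), so all index pairs together label one basis. *)
Definition sym_unit p : M :=
  if p.1 == p.2 then delta_mx p.1 p.2
  else delta_mx p.1 p.2 + transpose_sign p *: delta_mx p.2 p.1.

Definition sym_coord p x : C :=
  if p.1 == p.2 then x p.1 p.2
  else (x p.1 p.2 + transpose_sign p * x p.2 p.1) / 2.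

Lemma sym_coord_linear p : scalar (sym_coord p).
Proof.
by move=> k x y; rewrite /sym_coord; case: ifP => _; rewrite !mxE //; ring.
Qed.

HB.instance Definition _ p :=
  GRing.isLinear.Build C M C *%R (sym_coord p) (sym_coord_linear p).

Lemma transpose_sign_sqr p : transpose_sign p * transpose_sign p = 1.
Proof. by rewrite -expr2 sqrr_sign. Qed.

Lemma transpose_sign_swap (i j : 'I_N.+1) :
  i != j -> transpose_sign (j, i) = - transpose_sign (i, j).
Proof.
rewrite /transpose_sign -val_eqE /=.
by case: ltngtP => // _ _; rewrite ?expr0 ?expr1 ?opprK.
Qed.

Lemma sym_coord_unit p q : sym_coord p (sym_unit q) = (p == q)%:R.
Proof.
have two_neq0 : (2 : C) != 0 by rewrite pnatr_eq0.
case: p q => [i j] [k l]; rewrite /sym_coord /sym_unit /=.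
rewrite -[_ == (k, l)]/((i == k) && (j == l)).
have disj (a b c : 'I_N.+1) : a != b -> (a == c) && (b == c) = false.
  by apply: contraNF => /andP[/eqP-> /eqP->].
case: (altP (i =P j)) => [<-|ij]; case: (altP (k =P l)) => [<-|kl];
  rewrite !mxE //.
- by rewrite ![i == _]eq_sym [_ && (k == i)]andbC !disj // mulr0 addr0.
- by rewrite [(j == k) && _]andbC !disj // mulr0 addr0 mul0r.
rewrite [(j == l) && _]andbC [(j == k) && _]andbC.
case: (altP (i =P k)) => [ik|_]; case: (altP (j =P l)) => [jl|_]; rewrite /=.
- rewrite -ik -jl (negbTE ij) /= mulr0 addr0 add0r mulr1.
  by rewrite transpose_sign_sqr; field.
- by rewrite -ik [j == i]eq_sym (negbTE ij) andbF !(mulr0, addr0) mul0r.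
- by rewrite -jl (negbTE ij) !(mulr0, addr0) mul0r.
case: (altP (i =P l)) => [il|_]; case: (altP (j =P k)) => [jk|_];
  rewrite /= ?(mulr0, addr0, mul0r) //.
(* Swapped pairs carry opposite signs, so the two halves cancel. *)
by rewrite -il -jk (transpose_sign_swap ij); field.
Qed.

Lemma sym_coord_expansion x : x = \sum_p sym_coord p x *: sym_unit p.
Proof.
have two_neq0 : (2 : C) != 0 by rewrite pnatr_eq0.
(* The sums agree only when the terms at (i, j) and (j, i) are taken together, so both sides are
   doubled and their second copies re-indexed by the swap. *)
apply: (scalerI two_neq0); rewrite !scaler_nat !mulr2n.
pose swap p : I := (p.2, p.1).
have swap_inv : involutive swap by case.
have sumE : x = \sum_p x p.1 p.2 *: delta_mx p.1 p.2.
  by rewrite [LHS]matrix_sum_delta pair_bigA.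
rewrite {1 2}sumE [X in _ + X = _](reindex_inj (inv_inj swap_inv)) /=.
rewrite [X in _ = _ + X](reindex_inj (inv_inj swap_inv)) /=.
rewrite -!big_split; apply: eq_bigr => -[i j] _ /=.
rewrite /sym_coord /sym_unit /= [j == i]eq_sym.
case: (altP (i =P j)) => [-> //|ij].
rewrite (transpose_sign_swap ij).
move: (transpose_sign _) (transpose_sign_sqr (i, j)) => s ssq.
apply/matrixP => k l; rewrite !mxE.
by move: (_%:R) (_%:R) => a b; field: ssq.
Qed.

Lemma star_mxE x i j : x^☆ i j = (x j i)^*.
Proof. by rewrite -[x^☆]/(mxstar x) !mxE. Qed.

(** The entries are real, so the involution merely transposes: it swaps the two matrix units, and
    s^2 = 1 lets the sign s be pulled out. *)
Lemma star_sym_unit p : (sym_unit p)^☆ = transpose_sign p *: sym_unit p.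
Proof.
case: p => i j; rewrite /sym_unit /=.
have conj_sign : (transpose_sign (i, j))^* = transpose_sign (i, j).
  by rewrite rmorphXn rmorphN1.
apply/matrixP => k l; case: (altP (i =P j)) => [<-|ij].
  by rewrite star_mxE !mxE conjC_nat /transpose_sign ltnn mul1r andbC.
rewrite star_mxE !mxE rmorphD rmorphM /= !conjC_nat conj_sign.
by rewrite mulrDr mulrA transpose_sign_sqr mul1r addrC ![(l == _) && _]andbC.
Qed.

(** * Index pairs listed in the order of the blocks of Ω' *)

Definition lower_pairs : {set I} := [set p : I | (p.2 < p.1)%N].
(* (0, 0) is left out: the identity matrix takes the place of its unit. *)
Definition upper_pairs : {set I} :=
  [set p : I | (p != (ord0, ord0)) && (p.1 <= p.2)%N].
(** Symmetric units come first, as the block 1 of Ω' precedes the block -1. *)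
Definition basis_pairs : seq I := enum upper_pairs ++ enum lower_pairs.

Lemma mem_basis_pairs p : (p \in basis_pairs) = (p != (ord0, ord0)).
Proof.
rewrite mem_cat !mem_enum !inE leqNgt.
case: ltnP => [lt21|_]; last by rewrite andbT orbF.
by rewrite orbT; apply/esym/eqP => p0; rewrite p0 in lt21.
Qed.

Lemma basis_pairs_uniq : uniq basis_pairs.
Proof.
rewrite cat_uniq !enum_uniq andbT /=; apply/hasPn => p.
by rewrite !mem_enum !inE [(p.1 <= _)%N]leqNgt => ->; rewrite andbF.
Qed.

Lemma size_basis_pairs : size basis_pairs = (N.+1 ^ 2 - 1)%N.
Proof.
have /card_uniqP <- := basis_pairs_uniq.
rewrite (eq_card (B := predC1 (ord0, ord0))); last exact: mem_basis_pairs.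
by rewrite (cardC1 ((ord0, ord0) : I)) card_prod !card_ord -subn1 mulnn.
Qed.

(** The swap matches pairs below the diagonal with pairs above it; the N+1 diagonal pairs complete
    the (N+1)^2 pairs. *)
Lemma card_lower_pairs : #|lower_pairs| = (N.+1 * (N.+1 - 1) %/ 2)%N.
Proof.
pose swap p : I := (p.2, p.1).
have swap_inv : involutive swap by case.
have card_diag : #|[set p : I | p.1 == p.2]| = N.+1.
  have diag_inj : injective (fun i : 'I_N.+1 => (i, i)) by move=> i j [].
  rewrite -[RHS]card_ord -(card_imset predT diag_inj).
  apply: eq_card => -[i j]; rewrite !inE /=.
  by apply/eqP/imsetP => [->|[k _ [-> ->]] //]; exists j.
have card_upper : #|[set p : I | (p.1 < p.2)%N]| = #|lower_pairs|.
  rewrite -(card_imset lower_pairs (inv_inj swap_inv)); apply: eq_card => p.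
  by rewrite -[p in RHS]swap_inv (mem_imset _ _ (inv_inj swap_inv)) !inE.
have := cardsC (lower_pairs :|: [set p : I | p.1 == p.2]).
have -> : ~: (lower_pairs :|: [set p : I | p.1 == p.2])
    = [set p : I | (p.1 < p.2)%N].
  by apply/setP => p; rewrite !inE -val_eqE /=; case: ltngtP.
rewrite cardsU card_diag card_upper card_prod card_ord.
have -> : lower_pairs :&: [set p : I | p.1 == p.2] = set0.
  by apply/setP => p; rewrite !inE -val_eqE /=; case: ltngtP.
by rewrite cards0; lia.
Qed.

(** Obtained by subtraction: [Omega_dim] splits the total length into the two block sizes, and the
    lower part is already counted. *)
Lemma size_upper_pairs :
  size (enum upper_pairs) = ((N.+1 + 2) * (N.+1 - 1) %/ 2)%N.
Proof.
have := size_basis_pairs; rewrite size_cat -(Omega_dim N.+1).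
by rewrite -[size (enum lower_pairs)]cardE card_lower_pairs => /addIn.
Qed.

Local Notation d := (N.+1 ^ 2 - 1)%N.

Definition basis_pair (i : 'I_d) : I := nth (ord0, ord0) basis_pairs i.

Lemma basis_pair_inj : injective basis_pair.
Proof.
move=> i j /eqP; rewrite nth_uniq ?size_basis_pairs ?basis_pairs_uniq //.
by move/eqP/val_inj.
Qed.

Lemma basis_pair_neq0 i : basis_pair i != (ord0, ord0).
Proof. by rewrite -mem_basis_pairs mem_nth ?size_basis_pairs. Qed.

Lemma sum_basis_pair (V : nmodType) (F : I -> V) :
  \sum_p F p = F (ord0, ord0) + \sum_(i < d) F (basis_pair i).
Proof.
rewrite (bigD1 (ord0, ord0)) //=; congr (_ + _).
under eq_bigl do rewrite -mem_basis_pairs.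
rewrite -big_uniq ?basis_pairs_uniq // (big_nth (ord0, ord0)) size_basis_pairs.
by rewrite big_mkord.
Qed.

Lemma transpose_sign_basis_pair i : transpose_sign (basis_pair i) =
  if (i < (N.+1 + 2) * (N.+1 - 1) %/ 2)%N then 1 else -1.
Proof.
rewrite /transpose_sign /basis_pair nth_cat size_upper_pairs.
case: (ltnP i ((N.+1 + 2) * (N.+1 - 1) %/ 2)) => lei.
  have : nth (ord0, ord0) (enum upper_pairs) i \in enum upper_pairs.
    by rewrite mem_nth // size_upper_pairs.
  by rewrite mem_enum inE leqNgt => /andP[_ /negbTE->].
have : nth (ord0, ord0) (enum lower_pairs) (i - (N.+1 + 2) * (N.+1 - 1) %/ 2)
    \in enum lower_pairs.
  rewrite mem_nth // -size_upper_pairs ltn_subLR ?size_upper_pairs //.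
  by rewrite -size_upper_pairs -size_cat size_basis_pairs.
by rewrite mem_enum inE => ->.
Qed.

(** * The basis formed by 1 and the e_j *)

Definition basis_mx (i : 'I_d) : M := sym_unit (basis_pair i).

(* x - x_00 1 has no component along 1, since the e_j vanish at (0, 0). *)
Definition basis_coord (i : 'I_d) x : C :=
  sym_coord (basis_pair i) (x - x ord0 ord0 *: 1).

Lemma basis_coord_linear i : scalar (basis_coord i).
Proof.
move=> k x y; rewrite /basis_coord -linearP; congr (sym_coord _ _).
by apply/matrixP => p q; rewrite !mxE; ring.
Qed.

HB.instance Definition _ i :=
  GRing.isLinear.Build C M C *%R (basis_coord i) (basis_coord_linear i).

Lemma basis_coordZ i a x : basis_coord i (a *: x) = a * basis_coord i x.
Proof. exact: linearZ. Qed.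

(** This is the gain from leaving out (0, 0): since 1 has entry 1 there, entry (0, 0) of a matrix is
    its coordinate along 1. *)
Lemma basis_mx00 i : basis_mx i ord0 ord0 = 0.
Proof.
have := basis_pair_neq0 i; rewrite /basis_mx /sym_unit.
case: (basis_pair i) => k l; rewrite -[_ == _]/((k == _) && (l == _)) /= => kl.
have kl0 : (ord0 == k) && (ord0 == l) = false.
  by rewrite ![ord0 == _]eq_sym (negbTE kl).
by case: eqP => kl'; rewrite !mxE ?[(ord0 == l) && _]andbC kl0 // mulr0 addr0.
Qed.

Lemma basis_coord_mx i j : basis_coord i (basis_mx j) = (i == j)%:R.
Proof.
rewrite /basis_coord basis_mx00 scale0r subr0 sym_coord_unit.
by rewrite (inj_eq basis_pair_inj).
Qed.

Lemma basis_coord1 i : basis_coord i 1 = 0.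
Proof. by rewrite /basis_coord mxE eqxx scale1r subrr linear0. Qed.

Lemma basis_expansion x :
  x = x ord0 ord0 *: 1 + \sum_i basis_coord i x *: basis_mx i.
Proof.
rewrite [RHS]addrC; apply/(canRL (addrNK _)).
rewrite [in LHS](sym_coord_expansion (x - _)).
(* The term at (0, 0) vanishes because x - x_00 1 has entry 0 there. *)
rewrite sum_basis_pair [sym_coord (ord0, ord0) _](_ : _ = 0).
  by rewrite scale0r add0r.
by rewrite /sym_coord /= !mxE mulr1 subrr.
Qed.

Lemma star_basis_mx i :
  (basis_mx i)^☆ = transpose_sign (basis_pair i) *: basis_mx i.
Proof. exact: star_sym_unit. Qed.

(** The involution is conjugate-linear, fixes 1 and multiplies e_j by its sign, so it can be applied
    to the expansion of x term by term. *)
Lemma basis_coord_star i x :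
  basis_coord i x^☆ = transpose_sign (basis_pair i) * (basis_coord i x)^*.
Proof.
rewrite [x in LHS]basis_expansion starD starZ star1 star_sum linearD linear_sum.
rewrite linearZ /= basis_coord1 mulr0 add0r (bigD1 i) //= big1 => [|j ij].
  rewrite addr0 starZ star_basis_mx !linearZ /= basis_coord_mx eqxx.
  by rewrite mulr1 mulrC.
rewrite starZ star_basis_mx !linearZ /= basis_coord_mx eq_sym (negbTE ij).
by rewrite !mulr0.
Qed.
End SymmetricBasis.

(** * Block matrices and the isomorphism *)

Section PertIsom.
Local Open Scope ring_scope.
Variables (R : realType) (N : nat).
Local Notation C := R[i].
Local Notation M := 'M[C]_N.+1.
Local Notation d := (N.+1 ^ 2 - 1)%N.
Local Notation sign i := (transpose_sign C (basis_pair i)).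
Implicit Types (t : tensor M M^c) (v : 'rV[C]_d) (B : 'M[C]_d).

Lemma Omega_diag : Omega R N.+1 = diag_mx (\row_i sign i).
Proof.
apply/matrixP => i j; rewrite castmxE !mxE transpose_sign_basis_pair.
(* Indices are carried back along the cast, so that [splitP] can tell in which block each one
   lies. *)
rewrite -[i == j](inj_eq (@cast_ord_inj _ _ (esym (Omega_dim N.+1)))).
set i' := cast_ord _ i; set j' := cast_ord _ j.
rewrite -[nat_of_ord i]/(nat_of_ord i').
move: i' j' => i' j'.
case: (splitP i') => k ik; rewrite !mxE; case: (splitP j') => l jl;
  rewrite !mxE -?[i' == j']val_eqE /= ik jl.
- by [].
- by rewrite ltn_eqF ?mulr0n // (leq_trans (ltn_ord k)) ?leq_addr.
- by rewrite gtn_eqF ?mulr0n // (leq_trans (ltn_ord l)) ?leq_addr.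
- by rewrite eqn_add2l mulNrn.
Qed.

Lemma VOmegaP v : reflect (forall j, (v ord0 j)^* = sign j * v ord0 j)
  (v \in VOmega_pred (N := N.+1)).
Proof.
rewrite -topredE /= /VOmega_pred Omega_diag mul_mx_diag.
apply: (iffP eqP) => [/rowP vE j|vE]; first by have := vE j; rewrite !mxE mulrC.
by apply/rowP => j; rewrite !mxE vE mulrC.
Qed.

(** Ω' is its own inverse, so the relation defining S becomes conj(B) = Ω' B Ω', read entry by
    entry. *)
Lemma SOmegaP B : reflect (forall i j, (B i j)^* = sign i * B i j * sign j)
  (B \in SOmega_pred (N := N.+1)).
Proof.
rewrite -topredE /= /SOmega_pred Omega_diag mul_mx_diag mul_diag_mx.
apply: (iffP eqP) => [/matrixP BE i j|BE].
  have := BE i j; rewrite !mxE -mulrA => <-.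
  by rewrite mulrA transpose_sign_sqr mul1r.
by apply/matrixP => i j; rewrite !mxE BE !mulrA transpose_sign_sqr mul1r.
Qed.

Definition translation_part t : 'rV[C]_d :=
  \row_j tens_act t (basis_mx C j) ord0 ord0.
Definition linear_part t : 'M[C]_d :=
  \matrix_(i, j) basis_coord i (tens_act t (basis_mx C j)).

Lemma tens_act_basis t j : tens_act t (basis_mx C j) =
  translation_part t ord0 j *: 1 + \sum_i linear_part t i j *: basis_mx C i.
Proof.
rewrite [LHS]basis_expansion mxE; congr (_ + _).
by apply: eq_bigr => i _; rewrite mxE.
Qed.

Lemma translation_part_pert (x : Pert M) :
  translation_part (val x) \in VOmega_pred (N := N.+1).
Proof.
have [_ xC] := (is_pertP _).1 (is_pert_val x).
by apply/VOmegaP => j; rewrite !mxE -star_mxE -xC star_basis_mx linearZ mxE.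
Qed.

Lemma linear_part_pert (x : Pert M) :
  linear_part (val x) \in SOmega_pred (N := N.+1).
Proof.
have [_ xC] := (is_pertP _).1 (is_pert_val x).
apply/SOmegaP => i j; rewrite !mxE.
rewrite -[LHS]mul1r -(transpose_sign_sqr C (basis_pair i)) -[LHS]mulrA.
rewrite -basis_coord_star -xC star_basis_mx.
by rewrite !linearZ /= -mulrA; congr (_ * _); rewrite mulrC.
Qed.

Definition pert_semidirect (x : Pert M) : semidirect R N.+1 :=
  (MkVOmega (translation_part_pert x), MkSOmega (linear_part_pert x)).

Lemma pert_semidirectM : {morph pert_semidirect : x y / (x * y)%g}.
Proof.
move=> x y; have [x1 _] := (is_pertP _).1 (is_pert_val x).
(* The first factor fixes 1, so it leaves the term v'_j 1 of the expansion unchanged; this is where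
   v' in v' + vB' comes from. *)
have actM j : tens_act (val (x * y)%g) (basis_mx C j) =
    translation_part (val y) ord0 j *: 1
    + \sum_i linear_part (val y) i j *: tens_act (val x) (basis_mx C i).
  rewrite tens_actM [tens_act (val y) _]tens_act_basis linearD linear_sum /=.
  by rewrite linearZ /= x1; under eq_bigr do rewrite linearZ.
congr pair; apply/val_inj; apply/matrixP => i j.
  rewrite ord1 [RHS]mxE [LHS]mxE actM [LHS]mxE summxE; congr (_ + _).
    by rewrite !mxE eqxx mulr1.
  by rewrite mxE; apply: eq_bigr => k _; rewrite !mxE mulrC.
rewrite [LHS]mxE actM linearD linear_sum linearZ /= basis_coord1 mulr0 add0r.
rewrite -[RHS]/((linear_part (val x) *m linear_part (val y)) i j) [RHS]mxE.
apply: eq_bigr => k _.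
by rewrite basis_coordZ mulrC; congr (_ * _); rewrite mxE.
Qed.

HB.instance Definition _ :=
  isMultiplicative.Build (Pert M) (semidirect R N.+1)
    pert_semidirect pert_semidirectM.

(** The endomorphism with block matrix [[1, v], [0, B]]. *)
Definition semidirect_map v B (x : M) : M :=
  x ord0 ord0 *: 1 + \sum_j basis_coord j x *:
    (v ord0 j *: 1 + \sum_i B i j *: basis_mx C i).

Lemma semidirect_map_linear v B : linear (semidirect_map v B).
Proof.
move=> k x y; rewrite /semidirect_map scalerDr addrACA scalerA -scalerDl.
rewrite scaler_sumr -big_split !mxE; congr (_ + _).
by apply: eq_bigr => j _; rewrite basis_coord_linear scalerDl -scalerA.
Qed.

Lemma semidirect_map1 v B : semidirect_map v B 1 = 1.
Proof.
rewrite /semidirect_map mxE eqxx scale1r big1 ?addr0 // => j _.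
by rewrite basis_coord1 scale0r.
Qed.

Lemma semidirect_map_basis v B j : semidirect_map v B (basis_mx C j) =
  v ord0 j *: 1 + \sum_i B i j *: basis_mx C i.
Proof.
rewrite /semidirect_map basis_mx00 scale0r add0r (bigD1 j) //=.
rewrite [X in _ + X = _]big1 => [|k kj].
  by rewrite basis_coord_mx eqxx scale1r addr0.
by rewrite basis_coord_mx (negbTE kj) scale0r.
Qed.

(** Both sides are conjugate-linear in x, so it is enough to compare at each e_j: the component
    along 1 is the condition on v, those along the e_i the condition on B. *)
Lemma semidirect_map_star v B x : v \in VOmega_pred (N := N.+1) ->
  B \in SOmega_pred (N := N.+1) ->
  semidirect_map v B x^☆ = (semidirect_map v B x)^☆.
Proof.
move=> /VOmegaP vE /SOmegaP BE.
rewrite /semidirect_map starD starZ star1 star_sum star_mxE; congr (_ + _).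
apply: eq_bigr => j _; rewrite basis_coord_star starZ mulrC -scalerA.
congr (_ *: _); rewrite scalerDr starD starZ star1 star_sum vE scalerA.
congr (_ + _); rewrite scaler_sumr; apply: eq_bigr => i _.
rewrite starZ star_basis_mx !scalerA BE; congr (_ *: _).
(* The inserted ω_i^2 = 1 supplies the two factors ω_i of the other side. *)
by rewrite -[LHS]mul1r -(transpose_sign_sqr C (basis_pair i)); ring.
Qed.

Lemma is_pert_semidirect (x : semidirect R N.+1) :
  is_pert (tens_of_map (semidirect_map (val x.1) (val x.2))).
Proof.
have actE := tens_of_mapK (semidirect_map_linear (val x.1) (val x.2)).
apply/is_pertP; split=> [|y]; rewrite !actE; first exact: semidirect_map1.
exact: semidirect_map_star (valP x.1) (valP x.2).
Qed.

Definition semidirect_pert (x : semidirect R N.+1) : Pert M :=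
  MkPert (asboolT (is_pert_semidirect x)).

(** The action is faithful and T fixes 1, so T is recovered from its values on the e_j, which the
    two parts record. *)
Lemma pert_semidirectK : cancel pert_semidirect semidirect_pert.
Proof.
move=> x; have [x1 _] := (is_pertP _).1 (is_pert_val x).
apply/val_inj/tens_act_inj => y /=.
rewrite (tens_of_mapK (semidirect_map_linear _ _)) [y in RHS]basis_expansion.
rewrite linearD linearZ linear_sum /= x1 /semidirect_map; congr (_ + _).
by apply: eq_bigr => j _; rewrite linearZ /= -tens_act_basis.
Qed.

Lemma semidirect_pertK : cancel semidirect_pert pert_semidirect.
Proof.
move=> [v B].
have actE := tens_of_mapK (semidirect_map_linear (val v) (val B)).
congr pair; apply/val_inj/matrixP => i j.
  rewrite ord1 mxE actE semidirect_map_basis mxE summxE big1 => [|k _].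
    by rewrite !mxE mulr1 addr0.
  by rewrite mxE basis_mx00 mulr0.
rewrite mxE actE semidirect_map_basis linearD linearZ linear_sum /=.
rewrite basis_coord1 mulr0 add0r (bigD1 i) //= big1 => [|k ki].
  by rewrite linearZ /= basis_coord_mx eqxx mulr1 addr0.
by rewrite linearZ /= basis_coord_mx eq_sym (negbTE ki) mulr0.
Qed.
End PertIsom.

(* N.+1 is the matrix size, so that it ranges over the integers >= 1. *)
Theorem proposition3p10 (R : realType) (N : nat) :
  exists f : {multiplicative Pert 'M[R[i]]_N.+1 -> semidirect R N.+1},
    bijective f.
Proof.
exists (@pert_semidirect R N).
exact: Bijective (@pert_semidirectK R N) (@semidirect_pertK R N).
Qed.
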